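(* As $d\to\infty$, the critical probability $\dot{p}_c(\mathbb{Z}^d)$ of Bernoulli site percolation on $\mathbb{Z}^d$ satisfies $$\dot{p}_c(\mathbb{Z}^d)\geq \frac{1}{2d}+\frac{2}{(2d)^2}-O\!\left(\frac{1}{d^2\log(d)}\right).$$
   Context: $\mathbb{Z}^d$ denotes the hypercubic lattice, i.e. the graph with vertex set $\mathbb{Z}^d$ in which two vertices are adjacent when they are at Euclidean distance $1$. In Bernoulli site percolation with parameter $p\in[0,1]$, each vertex is independently declared occupied with probability $p$ and vacant otherwise; $\dot{p}_c(\mathbb{Z}^d)$ is the supremum of those $p$ for which, almost surely, the subgraph induced by the occupied vertices has no infinite component. $O(g(d))$ denotes a quantity whose absolute value is at most $C\,g(d)$ for some constant $C$ and all large $d$; $\log$ is the natural logarithm. *)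

(* Defs.v *)
From HB Require Import structures.
From mathcomp Require Import all_boot all_order all_algebra.
From mathcomp Require Import all_classical all_reals all_analysis.

Set Implicit Arguments.
Unset Strict Implicit.
Unset Printing Implicit Defensive.

Import Order.TTheory GRing.Theory Num.Theory.
Import numFieldNormedType.Exports.

Local Open Scope classical_set_scope.
Local Open Scope ring_scope.

Section lattice.
Variables (R : realType) (d : nat).

Definition edist (x y : 'rV[int]_d) : R :=
  Num.sqrt (\sum_(i < d) (x 0 i - y 0 i)%:~R ^+ 2).

Definition adj (x y : 'rV[int]_d) : bool := edist x y == 1.

End lattice.

Section configurations.
Variable d : nat.

(* [w x = true] means that the vertex [x] is occupied. *)
Definition config := 'rV[int]_d -> bool.

Definition occupied (x : 'rV[int]_d) : set config := [set w | w x].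

(* The product sigma-algebra on {0,1}^(Z^d). *)
Definition configType := g_sigma_algebraType (range occupied).

End configurations.

Section percolation.
Variables (R : realType) (d : nat).

(* Component of [x] in the subgraph induced by the occupied vertices; it is
   empty when [x] is vacant. *)
Definition component (w : config d) (x : 'rV[int]_d) : set 'rV[int]_d :=
  [set y | exists2 s : seq 'rV[int]_d,
     path (@adj R d) x s /\ last x s = y & all w (x :: s)].

Definition percolates (w : config d) : Prop :=
  exists x, infinite_set (component w x).

(* [P] is the product over Z^d of the Bernoulli distribution of parameter [p]:
   this prescribes [P] on the cylinders, hence determines it. *)
Definition is_bernoulli_percolation (p : R)
    (P : probability (configType d) R) : Prop :=
  forall (S : seq 'rV[int]_d) (b : config d), uniq S ->
    P [set w : config d | forall x, x \in S -> w x = b x] =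
    (\prod_(x <- S) bernoulli_pmf p (b x))%:E.

(* For each [p] in [0, 1] exactly one [P] satisfies [is_bernoulli_percolation p],
   so the existential merely names it. *)
Definition site_pc : R :=
  sup [set p : R | 0 <= p <= 1 /\
    exists2 P : probability (configType d) R,
      is_bernoulli_percolation p P & {ae P, forall w, ~ percolates w}].

End percolation.

(* Main.v *)
Require Import Defs.
From HB Require Import structures.
From mathcomp Require Import all_boot all_order all_algebra.
From mathcomp Require Import all_classical all_reals all_analysis.
From mathcomp Require Import ring lra zify measurable_realfun.
Import Order.TTheory GRing.Theory Num.Theory.
Import numFieldNormedType.Exports.
Local Open Scope classical_set_scope.
Local Open Scope ring_scope.

Set Implicit Arguments.
Unset Strict Implicit.
Unset Printing Implicit Defensive.

(** An infinite cluster contains geodesics of every length from each of its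
    vertices.  A geodesic is self-avoiding, and none of its steps is opposite to
    one of the two steps that precede it: [a, -a] can be deleted and [a, b, -a]
    replaced by [b].  With [m = 2d - 2], walks of length [n] with the latter
    property number at most a constant times [(m + 1/m)^n], so by the union
    bound there is no infinite cluster when [p (m + 1/m) < 1].  This holds for
    [p = 1/(2d) + 2/(2d)^2] as soon as [d >= 2], hence the error term can be
    taken to be [0]. *)

(** * Lattice walks, geodesics of a configuration, and the count of chordless walks *)

Section walks.
Variable d : nat.

Definition dir : finType := ('I_d * bool)%type.

Definition opp_dir (u : dir) : dir := (u.1, ~~ u.2).

Definition dir_vec (u : dir) : 'rV[int]_d := (-1) ^+ u.2 *: delta_mx 0 u.1.

Lemma opp_dirK : involutive opp_dir.
Proof. by case=> i b; rewrite /opp_dir /= negbK. Qed.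

Lemma dir_vec_opp (u : dir) : dir_vec (opp_dir u) = - dir_vec u.
Proof.
case: u => i [] /=; rewrite /dir_vec /=.
  by rewrite expr0 expr1 scale1r scaleN1r opprK.
by rewrite expr0 expr1 scale1r scaleN1r.
Qed.

(** The squared coordinate differences are nonnegative integers with sum 1, so exactly one of them
    is 1 and the others vanish. *)
Lemma adj_dir (R : realType) (x y : 'rV[int]_d) :
  adj R x y -> exists u : dir, y = x + dir_vec u.
Proof.
rewrite /adj /Defs.edist => /eqP xy1.
have sum1 : \sum_(i < d) (x 0 i - y 0 i) ^+ 2 = 1 :> int.
  apply/eqP; rewrite -(eqr_int R) rmorph_sum /=.
  under eq_bigr do rewrite rmorphXn /=.
  rewrite -[X in X == _]sqr_sqrtr; first by rewrite xy1 expr1n.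
  by apply: sumr_ge0 => i _; exact: sqr_ge0.
have [i xyi] : exists i, x 0 i - y 0 i != 0.
  apply/existsP; apply: contraPT sum1 => /existsPn xy0.
  by rewrite big1// => i _; move/negPn/eqP: (xy0 i) => ->; rewrite expr0n.
have sqi : 1 <= (x 0 i - y 0 i) ^+ 2 by rewrite -gtz0_ge1 exprn_even_gt0.
have rest_ge0 : 0 <= \sum_(j < d | j != i) (x 0 j - y 0 j) ^+ 2.
  by apply: sumr_ge0 => j _; exact: sqr_ge0.
move: sum1; rewrite (bigD1 i)//= => sum1.
have sqi1 : (x 0 i - y 0 i) ^+ 2 = 1.
  by apply/eqP; rewrite eq_le sqi -[X in _ <= X]sum1 lerDl rest_ge0.
move: sum1; rewrite sqi1 -[X in _ = X]addr0 => /addrI /psumr_eq0P rest0.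
have yj j : j != i -> y 0 j = x 0 j.
  move=> ji; apply/esym/eqP; rewrite -subr_eq0 -sqrf_eq0; apply/eqP.
  by apply: rest0 => // k _; exact: sqr_ge0.
move/eqP: sqi1; rewrite sqrf_eq1 => /orP[] /eqP xyi1.
- exists (i, true); apply/rowP => j; rewrite !mxE /= expr1.
  by have [->|/yj ->] := eqVneq j i; rewrite /=; lia.
- exists (i, false); apply/rowP => j; rewrite !mxE /= expr0.
  by have [->|/yj ->] := eqVneq j i; rewrite /=; lia.
Qed.

Definition disp (s : seq dir) : 'rV[int]_d := \sum_(u <- s) dir_vec u.

(** The starting vertex is left out, to match the list argument of [path]. *)
Definition walk (x : 'rV[int]_d) (s : seq dir) : seq 'rV[int]_d :=
  scanl (fun y u => y + dir_vec u) x s.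

Lemma disp_cat (s t : seq dir) : disp (s ++ t) = disp s + disp t.
Proof. exact: big_cat. Qed.

Lemma last_walk (x : 'rV[int]_d) (s : seq dir) : last x (walk x s) = x + disp s.
Proof.
elim: s x => [|u s IH] x; first by rewrite /disp big_nil addr0.
by rewrite /walk /= -/(walk _ _) IH /disp big_cons addrA.
Qed.

Lemma walk_cat (x : 'rV[int]_d) (s t : seq dir) :
  walk x (s ++ t) = walk x s ++ walk (x + disp s) t.
Proof.
elim: s x => [|u s IH] x; first by rewrite /disp big_nil addr0.
by rewrite /walk /= -!/(walk _ _) IH /disp big_cons addrA.
Qed.

Lemma path_walk (R : realType) (x : 'rV[int]_d) (s : seq 'rV[int]_d) :
  path (@adj R d) x s -> exists t, s = walk x t.
Proof.
elim: s x => [|y s IH] x /=; first by exists [::].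
by move=> /andP[/adj_dir[u ->] /IH[t ->]]; exists (u :: t).
Qed.

Lemma mem_walk (x y : 'rV[int]_d) (s : seq dir) :
  y \in x :: walk x s -> exists s1 s2, s = s1 ++ s2 /\ y = x + disp s1.
Proof.
elim: s x => [|u s IH] x /=.
  by rewrite inE => /eqP ->; exists [::], [::]; rewrite /disp big_nil addr0.
rewrite inE => /predU1P[->|/IH[s1 [s2 [-> ->]]]].
  by exists [::], (u :: s); rewrite /disp big_nil addr0.
by exists (u :: s1), s2; rewrite /disp big_cons addrA.
Qed.

Definition open_walk (w : config d) (x : 'rV[int]_d) (s : seq dir) : bool :=
  all w (x :: walk x s).

(** With a common start, equal displacement means equal endpoint: distances are those of the
    subgraph induced by the occupied vertices. *)
Definition geodesic (w : config d) (x : 'rV[int]_d) (s : seq dir) : Prop :=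
  open_walk w x s /\
  forall t, open_walk w x t -> disp t = disp s -> (size s <= size t)%N.

Lemma open_walk_cat (w : config d) (x : 'rV[int]_d) (s t : seq dir) :
  open_walk w x (s ++ t) = open_walk w x s && open_walk w (x + disp s) t.
Proof.
rewrite /open_walk walk_cat /= all_cat -last_walk.
case wx : (w x) => //=; case ws : (all w (walk x s)) => //=.
by have /allP/(_ _ (mem_last _ _)) -> : all w (x :: walk x s) by rewrite /= wx.
Qed.

(** A shorter open way to the end of [s], followed by [t], would beat [s ++ t]. *)
Lemma geodesic_prefix (w : config d) (x : 'rV[int]_d) (s t : seq dir) :
  geodesic w x (s ++ t) -> geodesic w x s.
Proof.
case; rewrite open_walk_cat => /andP[ws wt] minst; split=> // s' ws' ss'.
have := minst (s' ++ t); rewrite open_walk_cat ws' ss' wt !disp_cat ss'.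
by rewrite !size_cat leq_add2r; apply.
Qed.

(* A replacement of at most one step visits only vertices of the walk. *)
Lemma geodesic_shortcut (w : config d) (x : 'rV[int]_d) (s1 s2 s3 t : seq dir) :
  geodesic w x (s1 ++ s2 ++ s3) -> disp t = disp s2 -> (size t <= 1)%N ->
  (size s2 <= size t)%N.
Proof.
case; rewrite !open_walk_cat => /and3P[ws1 ws2 ws3] mins ts2 t1.
have wt : open_walk w (x + disp s1) t.
  have /allP ws2' := ws2.
  case: t t1 ts2 {mins} => [|u []]//= _; rewrite /open_walk /= ws2' ?mem_head//.
  rewrite /disp big_seq1 -/(disp s2) => ->.
  by rewrite -last_walk ws2'// mem_last.
have := mins (s1 ++ t ++ s3).
by rewrite !open_walk_cat ws1 wt ts2 ws3 !disp_cat ts2 !size_cat leq_add2l leq_add2r; apply.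
Qed.

(** By induction on prefixes only the last vertex can be a repetition; it would close a loop, which
    the empty walk shortcuts. *)
Lemma geodesic_uniq (w : config d) (x : 'rV[int]_d) (s : seq dir) :
  geodesic w x s -> uniq (x :: walk x s).
Proof.
elim/last_ind: s => [//|s u IH]; rewrite -cats1 => gsu.
rewrite walk_cat -cat_cons cats1 rcons_uniq IH ?andbT; last exact: geodesic_prefix gsu.
apply/negP => /mem_walk[s1 [s2 [ss xsu]]].
have s2u0 : disp s2 + dir_vec u = 0.
  by apply: (addrI (x + disp s1)); rewrite addr0 addrA -(addrA x) -disp_cat -ss.
have := @geodesic_shortcut w x s1 (s2 ++ [:: u]) [::] [::].
rewrite cats0 catA -ss => /(_ gsu).
rewrite size_cat addn1 disp_cat /disp big_nil big_seq1 s2u0.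
by move=> /(_ erefl isT).
Qed.

(* [s] may follow the steps [a], [b] in a walk none of whose steps is opposite
   to one of the two steps that precede it. *)
Fixpoint continuations (n : nat) (a b : dir) : seq (seq dir) :=
  if n is n'.+1 then
    [seq c :: t | c <- [seq c <- enum {: dir} | (c != opp_dir a) && (c != opp_dir b)],
                  t <- continuations n' b c]
  else [:: [::]].

Definition chordless_walks (n : nat) : seq (seq dir) :=
  [seq [:: ab.1, ab.2 & t] | ab <- enum {: dir * dir},
                             t <- continuations n ab.1 ab.2].

Lemma size_chordless (n : nat) (s : seq dir) :
  s \in chordless_walks n -> size s = n.+2.
Proof.
move=> /allpairsPdep[[a b] [t [_ + ->]]] /=.
elim: n a b t => [|n IH] a b t /=; first by rewrite inE => /eqP ->.
by move=> /allpairsPdep[c [t' [_ /IH /= [tn] ->]]] /=; rewrite tn.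
Qed.

(** The prefix [s] is arbitrary so that the induction can shift [a] into it. *)
Lemma geodesic_continuation (w : config d) (x : 'rV[int]_d) (s t : seq dir) (a b : dir) :
  geodesic w x (s ++ [:: a, b & t]) -> t \in continuations (size t) a b.
Proof.
elim: t s a b => [|c t IH] s a b gs; first by rewrite inE.
apply/allpairsPdep; exists c, t; split=> //; last first.
  by apply: (IH (s ++ [:: a])); rewrite -catA.
rewrite mem_filter mem_enum andbT; apply/andP; split; apply/eqP => cE; subst c.
- have := @geodesic_shortcut w x s [:: a; b; opp_dir a] t [:: b] gs.
  rewrite /disp !big_cons big_nil dir_vec_opp addr0 addrCA addr0 subrr addr0.
  by move=> /(_ erefl isT).
- have := @geodesic_shortcut w x (s ++ [:: a]) [:: b; opp_dir b] t [::].
  rewrite -catA /disp !big_cons !big_nil dir_vec_opp addr0 subrr.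
  by move=> /(_ gs erefl isT).
Qed.

Lemma geodesic_chordless (w : config d) (x : 'rV[int]_d) (s : seq dir) (n : nat) :
  geodesic w x s -> size s = n.+2 -> s \in chordless_walks n.
Proof.
case: s => [|a [|b t]]//= gs [<-]; apply/allpairsPdep; exists (a, b), t.
by split=> //; [rewrite mem_enum | exact: (@geodesic_continuation w x [::])].
Qed.

(* The function [(a, b) |-> 1 + [a = b] / m] is a supersolution, with growth
   rate [m + 1 / m], of the recursion that counts the continuations. *)
Lemma size_continuations (R : realFieldType) (m : R) (n : nat) (a b : dir) :
  (1 < d)%N -> m = (2 * d)%:R - 2 ->
  (size (continuations n a b))%:R <= (m + m^-1) ^+ n * (1 + (a == b)%:R * m^-1).
Proof.
move=> d1 mE.
have m0 : 0 < m by rewrite mE -natrB ?ltr0n; lia.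
have mV0 : 0 < m^-1 by rewrite invr_gt0.
elim: n a b => [|n IH] a b.
  rewrite expr0 mul1r lerDl mulr_ge0//; exact: ltW.
rewrite /= size_allpairs_dep sumnE big_map big_filter natr_sum.
apply: (@le_trans _ _ (\sum_(c : dir | (c != opp_dir a) && (c != opp_dir b))
    (m + m^-1) ^+ n * (1 + (b == c)%:R * m^-1))).
  by rewrite big_enum_cond /=; apply: ler_sum => c _; exact: IH.
rewrite -mulr_sumr exprSr -mulrA ler_pM2l; last by rewrite exprn_gt0// addr_gt0.
rewrite big_split /= -mulr_suml.
(* The only possible contribution is [c = b], which is excluded when [b] is opposite to [a]. *)
have eqb_le1 : \sum_(c : dir | (c != opp_dir a) && (c != opp_dir b)) (b == c)%:R <= 1 :> R.
  rewrite big_mkcond /= (bigD1 b)//= eqxx big1 ?addr0; first by case: ifP.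
  by move=> c /negbTE cb; rewrite [b == c]eq_sym cb if_same.
(* The two forbidden directions coincide exactly when [a = b]. *)
have card_le : \sum_(c : dir | (c != opp_dir a) && (c != opp_dir b)) 1 =
    m + (a == b)%:R :> R.
  rewrite sumr_const; apply/eqP; rewrite mE addrAC eq_sym subr_eq -!natrD eqr_nat.
  have := cardC (pred2 (opp_dir a) (opp_dir b)).
  rewrite card2 (inj_eq (inv_inj opp_dirK)) card_prod card_ord card_bool.
  rewrite (eq_card (A := [predC _])
    (B := fun c : dir => (c != opp_dir a) && (c != opp_dir b))).
    by case: (a == b) => /=; lia.
  by move=> c; rewrite !inE negb_or.
rewrite card_le.
have : (\sum_(c : dir | (c != opp_dir a) && (c != opp_dir b)) (b == c)%:R) * m^-1 <= m^-1.
  by rewrite -[leRHS]mul1r ler_wpM2r// ltW.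
have mmV : m * m^-1 = 1 by rewrite mulfV ?gt_eqF.
have mV2 : 0 < m^-1 * m^-1 by rewrite mulr_gt0.
(* What remains is [m + [a = b] + 1/m <= (m + 1/m) (1 + [a = b] / m)]: an equality if [a] and [b]
   differ, with slack [1/m^2] otherwise. *)
by rewrite mulrDr !mulrDl mulrCA mmV; case: (a == b) => /=; lra.
Qed.

Lemma size_chordless_walks (R : realFieldType) (m : R) (n : nat) :
  (1 < d)%N -> m = (2 * d)%:R - 2 ->
  (size (chordless_walks n))%:R <= ((2 * d) ^ 2)%:R * (1 + m^-1) * (m + m^-1) ^+ n.
Proof.
move=> d1 mE.
have m0 : 0 < m by rewrite mE -natrB ?ltr0n; lia.
have mV0 : 0 < m^-1 by rewrite invr_gt0.
rewrite size_allpairs_dep sumnE big_map big_enum natr_sum /=.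
apply: (@le_trans _ _ (\sum_(ab : dir * dir) (1 + m^-1) * (m + m^-1) ^+ n)).
  apply: ler_sum => -[a b] _ /=; apply: (le_trans (size_continuations n a b d1 mE)).
  rewrite [leLHS]mulrC; apply: ler_wpM2r.
    by rewrite exprn_ge0// addr_ge0// ltW.
  by case: (a == b) => /=; lra.
rewrite sumr_const !card_prod card_ord card_bool -[leLHS]mulr_natl mulrA.
by rewrite (_ : (d * 2 * (d * 2) = (2 * d) ^ 2)%N)//; lia.
Qed.

Lemma open_walk_geodesic (w : config d) (x : 'rV[int]_d) (s : seq dir) :
  open_walk w x s -> exists2 t, geodesic w x t & disp t = disp s.
Proof.
move=> ws.
pose P n := `[< exists t, [/\ open_walk w x t, disp t = disp s & size t = n] >].
have exP : exists n, P n by exists (size s); apply/asboolP; exists s.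
case: (ex_minnP exP) => n /asboolP[t [wt ts tn]] minn.
exists t => //; split=> // t' wt' t't; rewrite tn; apply: minn.
by apply/asboolP; exists t'; rewrite t't ts.
Qed.

(** Prefixes of geodesics are geodesics, so if none has length [n], all are shorter. The component
    then lies in the finite set of endpoints of words of fewer than [n] steps. *)
Lemma infinite_component_geodesic (R : realType) (w : config d) (x : 'rV[int]_d) (n : nat) :
  infinite_set (component R w x) -> exists2 s, geodesic w x s & size s = n.
Proof.
move=> infC; apply: contrapT => noG; apply: infC.
apply: (@sub_finite_set _ _
    ((fun t : {k : 'I_n & k.-tuple dir} => x + disp (tagged t)) @` setT)); last first.
  exact/finite_image/finite_finset.
move=> y [_ [/path_walk[s ->]] xy ws].
have [t gt ts] := open_walk_geodesic ws.
have tn : (size t < n)%N.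
  rewrite ltnNge; apply/negP => nt; apply: noG; exists (take n t); last exact: size_takel.
  by apply: (@geodesic_prefix w x _ (drop n t)); rewrite cat_take_drop.
exists (Tagged (fun k : 'I_n => k.-tuple dir) (in_tuple t : (Ordinal tn).-tuple dir)) => //=.
by rewrite ts -last_walk.
Qed.

End walks.

(** * Independent Bernoulli digits of a uniform point of [0, 1[ *)

Section uniform01.
Variable R : realType.

Definition uniform01 :=
  mrestr (@lebesgue_measure R) (measurable_itv `[0%R, 1%R[).

HB.instance Definition _ := Measure.on uniform01.

Let uniform01_setT : uniform01 setT = 1%E.
Proof. by rewrite /uniform01 /mrestr setTI lebesgue_measure_itv /= lte01 oppr0 adde0. Qed.

HB.instance Definition _ := Measure_isProbability.Build _ _ _ uniform01 uniform01_setT.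

End uniform01.
Arguments uniform01 : clear implicits.

Section bernoulli_sequence.
Variables (R : realType) (p : R).
Hypotheses (p_gt0 : 0 < p) (p_lt1 : p < 1).

(* The digits of a uniform point [x] of [0, 1[ are independent Bernoulli
   variables: the first one tells whether [x < p], and the next ones are the
   digits of the position of [x] in [0, p[ or in [p, 1[, rescaled to [0, 1[. *)
Definition rescale (x : R) : R := if x < p then x / p else (x - p) / (1 - p).

Definition digit (n : nat) (x : R) : bool := iter n rescale x < p.

Lemma measurable_rescale : measurable_fun setT rescale.
Proof.
apply: measurable_fun_ifT.
- exact: measurable_fun_ltr.
- exact: measurable_funM.
- by apply: measurable_funM => //; exact: measurable_funB.
Qed.

Lemma measurable_digit (n : nat) : measurable [set x | digit n x].
Proof.
have mr : measurable_fun setT (iter n rescale).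
  elim: n => [|n IH]; first exact: measurable_id.
  exact: measurableT_comp measurable_rescale IH.
have := mr measurableT `]-oo, p[%classic (measurable_itv _).
by rewrite setTI set_itvE.
Qed.

(** An entry [None] leaves its digit free, so that a condition on a scattered finite set of indices
    is still given by a list. *)
Definition digit_spec (l : seq (option bool)) : set R :=
  [set x | 0 <= x < 1 /\
    forall i, (i < size l)%N -> if nth None l i is Some b then digit i x = b else True].

Lemma digit_spec_cons (o : option bool) (l : seq (option bool)) (x : R) :
  digit_spec (o :: l) x <-> [/\ 0 <= x < 1, if o is Some b then (x < p) = b else True &
    digit_spec l (rescale x)].
Proof.
split=> [[x01 xl]|[x01 xo [_ xl]]].
  split=> //; first exact: (xl 0%N).
  split; last by move=> i il; have := xl i.+1 il; rewrite /digit iterSr.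
  move/andP: x01 => [x0 x1]; rewrite /rescale.
  have [xp|px] := ltP x p; apply/andP; split.
  - by apply: divr_ge0; lra.
  - by rewrite ltr_pdivrMr; lra.
  - by apply: divr_ge0; lra.
  - by rewrite ltr_pdivrMr; lra.
by split=> // -[|i] il //=; have := xl i il; rewrite /digit iterSr.
Qed.

Lemma digit_spec_cat (l1 l2 : seq (option bool)) (x : R) :
  digit_spec (l1 ++ l2) x <->
  digit_spec l1 x /\ digit_spec l2 (iter (size l1) rescale x).
Proof.
elim: l1 x => [|o l1 IH] x; first by split=> [xl|[]//]; split=> //; case: xl.
rewrite [size _]/= iterSr cat_cons; split.
  by move=> /digit_spec_cons[x01 xo /IH[xl1 xl2]]; split=> //; apply/digit_spec_cons.
move=> [/digit_spec_cons[x01 xo xl1] xl2]; apply/digit_spec_cons; split=> //.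
exact/IH.
Qed.

Lemma measurable_digit_spec (l : seq (option bool)) : measurable (digit_spec l).
Proof.
rewrite (_ : digit_spec l = `[0, 1[%classic `&` \bigcap_(i in `I_(size l))
    (if nth None l i is Some b then [set x | digit i x = b] else setT)).
  apply: measurableI; first exact: measurable_itv.
  apply: bigcap_measurableType => i _; case: (nth None l i) => [[]|]//.
    exact: measurable_digit.
  rewrite (_ : mkset _ = ~` [set x | digit i x]).
    by apply: measurableC; exact: measurable_digit.
  by apply/seteqP; split=> x /=; [move=> -> | move/negP/negbTE].
apply/seteqP; split=> x; rewrite /digit_spec /= in_itv /= => -[x01 xl]; split=> // i il.
  by have := xl i il; case: nth.
by have := xl i il; case: nth.
Qed.

(** Left endpoint of the interval of points whose digits begin with [w]. *)
Fixpoint word_left (w : seq bool) : R :=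
  if w is b :: w' then
    if b then p * word_left w' else p + (1 - p) * word_left w'
  else 0.

(** Prepending a digit pulls the interval back through one affine branch of [rescale], which
    multiplies its length by [p] or [1 - p]. The bounds 0 and 1 keep the result inside the domain of
    that branch. *)
Lemma digit_spec_word (w : seq bool) (l := \prod_(b <- w) bernoulli_pmf p b) :
  digit_spec (map some w) = `[word_left w, word_left w + l[%classic /\
  0 <= word_left w /\ 0 <= l /\ word_left w + l <= 1.
Proof.
have [p0 p1] := (p_gt0, p_lt1).
have q_gt0 : 0 < 1 - p by lra.
rewrite {}/l; elim: w => [|b w [IH [IH0 [IHl IH1]]]] /=.
  rewrite big_nil add0r; split; last by rewrite !lexx ler01.
  by apply/seteqP; split=> x; rewrite /digit_spec /= in_itv /= => // -[].
rewrite big_cons; move: (\prod_(_ <- w) _) (word_left w) IH IH0 IHl IH1 => l a IH a0 l0 al1.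
split; last by clear IH; case: b => /=; rewrite /bernoulli_pmf; split; [|split| |split]; nra.
apply/seteqP; split=> x.
  move=> /digit_spec_cons[x01 xb]; rewrite IH /= !in_itv /= => /andP[].
  move: xb; rewrite /rescale; case: b; case: ltP => //= xp _.
    by rewrite /bernoulli_pmf ler_pdivlMr// ltr_pdivrMr//; nra.
  by rewrite /bernoulli_pmf ler_pdivlMr// ltr_pdivrMr//; nra.
rewrite /= in_itv /= => /andP[x0 x1]; apply/digit_spec_cons; rewrite IH /= in_itv /=.
move: x0 x1; rewrite /bernoulli_pmf /rescale; case: b => x0 x1.
  have xp : x < p by nra.
  rewrite xp ler_pdivlMr// ltr_pdivrMr//; split=> //; nra.
have /negbTE xp : ~~ (x < p) by rewrite -leNgt; nra.
rewrite xp ler_pdivlMr// ltr_pdivrMr//; split=> //; nra.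
Qed.

(** Each free digit is split into its two values, whose weights add up to 1, until all digits are
    fixed and the set is an interval. The prefix [w] collects the digits already fixed. *)
Lemma uniform01_digit_spec (l : seq (option bool)) :
  uniform01 R (digit_spec l) = (\prod_(o <- l) oapp (bernoulli_pmf p) 1 o)%:E.
Proof.
suff H w : uniform01 R (digit_spec (map some w ++ l)) =
    (\prod_(b <- w) bernoulli_pmf p b * \prod_(o <- l) oapp (bernoulli_pmf p) 1 o)%:E.
  by have := H [::]; rewrite big_nil mul1r.
elim: l w => [|[b|] l IH] w.
- rewrite cats0 big_nil mulr1 /uniform01 /mrestr.
  have [-> [a0 [l0 al1]]] := digit_spec_word w.
  rewrite setIidl; last first.
    by move=> x /=; rewrite !in_itv /= => /andP[] *; apply/andP; split; lra.
  rewrite lebesgue_measure_itv /= lte_fin; case: ltP => [_|].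
    by rewrite -EFinB addrAC subrr add0r.
  (* In the degenerate case of the interval length formula, the product is 0. *)
  by rewrite gerDl => l_le0; congr EFin; apply/eqP; rewrite eq_le l0 l_le0.
- by rewrite -cat_rcons -map_rcons IH big_rcons /= big_cons /= mulrA.
- rewrite (_ : digit_spec _ = digit_spec (map some (rcons w true) ++ l) `|`
      digit_spec (map some (rcons w false) ++ l)).
    rewrite measureU; [|exact: measurable_digit_spec|exact: measurable_digit_spec|].
      rewrite /= !IH -EFinD; congr EFin; rewrite !big_rcons big_cons /= /bernoulli_pmf; ring.
    rewrite -subset0 => x []; rewrite !map_rcons !cat_rcons.
    move=> /digit_spec_cat[_ /digit_spec_cons[_ xt _]].
    by move=> /digit_spec_cat[_ /digit_spec_cons[_ xf _]]; rewrite xt in xf.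
  rewrite !map_rcons !cat_rcons; apply/seteqP; split=> x.
    move=> /digit_spec_cat[xw /digit_spec_cons[y01 _ yl]].
    case E : (iter (size (map some w)) rescale x < p); [left|right];
      by apply/digit_spec_cat; split=> //; apply/digit_spec_cons.
  move=> [] /digit_spec_cat[xw /digit_spec_cons[y01 _ yl]];
    by apply/digit_spec_cat; split=> //; apply/digit_spec_cons.
Qed.

End bernoulli_sequence.

(** * Existence of the percolation measure *)

Section bernoulli_percolation.
Variables (R : realType) (d : nat) (p : R).

Definition digit_config (x : measurableTypeR R) : configType d :=
  fun v => digit p (pickle v) x.

Lemma measurable_digit_config : measurable_fun setT digit_config.
Proof.
apply: (@measurability _ _ (measurableTypeR R) (configType d) _ _ (range (@occupied d)) erefl).
move=> _ [_ [v _ <-] <-]; rewrite setTI.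
exact: measurable_digit.
Qed.

HB.instance Definition _ :=
  isMeasurableFun.Build _ _ _ _ digit_config measurable_digit_config.

(** Membership of [p] in the set whose supremum is [site_pc] requires such a [P]. *)
Lemma bernoulli_percolation_exists :
  0 < p -> p < 1 ->
  exists P : probability (configType d) R, is_bernoulli_percolation p P.
Proof.
move=> p0 p1; exists (distribution (uniform01 R) digit_config) => S b uS.
(* Indices that are not codes of vertices of [S] must be free. This is why [pickle_inv] is used: it
   is [None] outside the range of [pickle]. *)
pose spec i := obind (fun v => if v \in S then Some (b v) else None)
  (@pickle_inv 'rV[int]_d i).
have specK v : v \in S -> spec (pickle v) = Some (b v).
  by move=> vS; rewrite /spec pickleK_inv /= vS.
have specN i : i \notin map pickle S -> spec i = None.
  rewrite /spec; case E : (pickle_inv i) => [v|]//=; case: ifP => // vS /negP[].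
  by apply/mapP; exists v => //; have := @pickle_invK 'rV[int]_d i; rewrite E.
have [N ltN] : exists N, forall v, v \in S -> (pickle v < N)%N.
  by exists (\max_(v <- S) pickle v).+1 => v vS; rewrite ltnS; exact: leq_bigmax_seq.
transitivity (uniform01 R (digit_spec p (mkseq spec N))).
  rewrite /distribution /pushforward /= /uniform01 /mrestr; congr lebesgue_measure.
  apply/seteqP; split=> x /=; rewrite in_itv /=.
    move=> [xb x01]; split=> //; split=> // i; rewrite size_mkseq => iN.
    rewrite nth_mkseq//; have [/mapP[v vS ->]|/specN ->//] := boolP (i \in map pickle S).
    by rewrite specK//; exact: xb.
  move=> [[_ xs] x01]; split=> // v vS; have := xs (pickle v).
  by rewrite size_mkseq nth_mkseq ?ltN// specK//; exact.
rewrite uniform01_digit_spec//; congr EFin.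
rewrite /mkseq big_map -[RHS](_ : \prod_(i <- map pickle S) oapp (bernoulli_pmf p) 1 (spec i) = _).
  (* Free indices contribute the factor 1; the others are the codes of [S] in another order. *)
  rewrite (bigID (fun i => i \in map pickle S)) /= [X in _ * X]big1 ?mulr1; last first.
    by move=> i /specN ->.
  rewrite -big_filter; apply/perm_big/uniq_perm.
  - by rewrite filter_uniq// iota_uniq.
  - by rewrite map_inj_uniq//; exact/pcan_inj/pickleK.
  - move=> i; rewrite mem_filter mem_iota /= add0n.
    by case: mapP => //= -[v vS ->]; exact: ltN.
rewrite big_map; apply: eq_big_seq => v vS /=.
by rewrite specK.
Qed.

End bernoulli_percolation.

(** * The union bound and the absence of infinite clusters *)

Lemma measure_bigsetU_le (disp : measure_display) (T : measurableType disp) (R : realType)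
    (mu : {measure set T -> \bar R}) (I : Type) (s : seq I) (A : I -> set T) :
  (forall i, measurable (A i)) ->
  (mu (\big[setU/set0]_(i <- s) A i) <= \sum_(i <- s) mu (A i))%E.
Proof.
move=> mA; elim: s => [|i s IH]; first by rewrite !big_nil measure0.
rewrite !big_cons; apply: le_trans (leeD2l _ IH).
by apply: measureU2 => //; exact: bigsetU_measurable.
Qed.

Section subcritical.
Variables (R : realType) (d : nat) (p : R) (P : probability (configType d) R).
Hypothesis bernP : is_bernoulli_percolation p P.

Lemma measurable_open_walk (x : 'rV[int]_d) (s : seq (dir d)) :
  measurable ([set w | open_walk w x s] : set (configType d)).
Proof.
rewrite (_ : mkset _ = \big[setI/setT]_(y <- x :: walk x s) @occupied d y).
  apply: bigsetI_measurable => y _; apply: sub_sigma_algebra.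
  by exists y.
apply/seteqP; split=> w /=; rewrite /open_walk -bigcap_seq.
  by move=> /allP ws y /ws.
by move=> ws; apply/allP.
Qed.

Lemma probability_open_walk (x : 'rV[int]_d) (s : seq (dir d)) :
  uniq (x :: walk x s) -> P [set w | open_walk w x s] = (p ^+ (size s).+1)%:E.
Proof.
move=> us; have := bernP (fun=> true) us.
rewrite big_const_seq count_predT /= iter_mulr_1 size_scanl exprS => <-.
by congr (P _); apply/seteqP; split=> w /allP.
Qed.

Lemma negligible_infinite_component (m : R) (x : 'rV[int]_d) :
  (1 < d)%N -> m = (2 * d)%:R - 2 -> 0 <= p -> p * (m + m^-1) < 1 ->
  P.-negligible [set w | infinite_set (component R w x)].
Proof.
move=> d1 mE p0 pm1.
have m0 : 0 < m by rewrite mE -natrB ?ltr0n; lia.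
have mV0 : 0 < m^-1 by rewrite invr_gt0.
(* Only self-avoiding walks are kept, since the probability of being open is known for distinct
   vertices. *)
pose A n : set (configType d) :=
  \big[setU/set0]_(s <- [seq s <- chordless_walks d n | uniq (x :: walk x s)])
    [set w | open_walk w x s].
have mA n : measurable (A n).
  by apply: bigsetU_measurable => s _; exact: measurable_open_walk.
(* A walk in [chordless_walks d n] has [n + 2] steps, hence [n + 3] vertices, whereas the count
   grows like a power of exponent [n]: this leaves [p ^+ 3]. *)
pose K : R := ((2 * d) ^ 2)%:R * (1 + m^-1) * p ^+ 3.
have PA n : (P (A n) <= (K * (p * (m + m^-1)) ^+ n)%:E)%E.
  apply: le_trans (measure_bigsetU_le _ _ _) _; first exact: measurable_open_walk.
  apply: (@le_trans _ _ (\sum_(s <- chordless_walks d n) (p ^+ n.+3)%:E)%E).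
    rewrite big_filter big_mkcond /=.
    rewrite big_seq [leRHS]big_seq; apply: lee_sum => s /size_chordless sn.
    case: ifP => [us|_]; last by rewrite lee_fin exprn_ge0.
    by rewrite probability_open_walk// sn.
  rewrite sumEFin lee_fin big_const_seq count_predT iter_addr_0 -mulr_natl.
  apply: le_trans (ler_wpM2r (exprn_ge0 _ p0) (size_chordless_walks n d1 mE)) _.
  by rewrite /K exprMn -addn3 exprD le_eqVlt; apply/orP; left; apply/eqP; ring.
(* Negligibility asks for a measurable null cover; the probability of this intersection is at most
   that of each [A n], which tends to 0. *)
exists (\bigcap_n A n); split.
- exact: bigcap_measurableType.
- apply/eqP; rewrite eq_le measure_ge0 andbT.
  apply/lee_addgt0Pr => e e0; rewrite add0e.
  have : (fun n => K * (p * (m + m^-1)) ^+ n) @ \oo --> K * 0.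
    apply: cvgMr; apply: cvg_expr; rewrite ger0_norm// mulr_ge0// addr_ge0// ltW//.
  rewrite mulr0 => /cvgr0_norm_lt/(_ _ e0)[n _ /(_ n (leqnn n)) /= Kn].
  apply: (@le_trans _ _ (P (A n))).
    by apply: le_measure; rewrite ?inE//; [exact: bigcap_measurableType|exact: bigcap_inf].
  by rewrite (le_trans (PA n))// lee_fin (le_trans (ler_norm _))// ltW.
- move=> w winf n _; rewrite /A -bigcup_seq.
  have [s gs sn] := infinite_component_geodesic n.+2 winf.
  exists s; last by case: gs.
  rewrite /mkset mem_filter (geodesic_chordless gs sn) andbT.
  exact: geodesic_uniq gs.
Qed.

Lemma ae_not_percolates (m : R) :
  (1 < d)%N -> m = (2 * d)%:R - 2 -> 0 <= p -> p * (m + m^-1) < 1 ->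
  {ae P, forall w, ~ percolates R w}.
Proof.
move=> d1 mE p0 pm1; rewrite /almost_everywhere.
(* There are countably many vertices; an index that decodes to none stands for the origin. *)
apply: (@negligibleS _ _ _ P (\bigcup_n [set w | infinite_set (component R w
    (odflt 0 (unpickle n : option 'rV[int]_d)))])).
  by move=> w /= /contrapT[x xinf]; exists (pickle x) => //=; rewrite pickleK.
by apply: negligible_bigcup => n; exact: negligible_infinite_component pm1.
Qed.

End subcritical.

(** * Lower bounds on the critical probability *)

Lemma site_pc_ge (R : realType) (d : nat) (p m : R) :
  (1 < d)%N -> m = (2 * d)%:R - 2 -> 0 < p < 1 -> p * (m + m^-1) < 1 ->
  p <= site_pc R d.
Proof.
move=> d1 mE /andP[p0 p1] pm1; apply: ub_le_sup.
  (* [sup] is a genuine supremum here because 1 bounds the set. *)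
  by exists 1 => q [/andP[]].
split; first by rewrite !ltW.
have [P bernP] := bernoulli_percolation_exists d p0 p1.
by exists P => //; exact (ae_not_percolates bernP d1 mE (ltW p0) pm1).
Qed.

Theorem theorem4p4 (R : realType) :
  exists2 E : nat -> R,
    E =O_\oo (fun d : nat => (d%:R ^+ 2 * ln d%:R)^-1 : R) &
    \forall d \near \oo,
      site_pc R d >= ((2 * d)%:R)^-1 + 2 / ((2 * d)%:R) ^+ 2 - E d.
Proof.
exists (fun=> 0); first by apply/eqOP/(@bigO0_subproof _ _ R R).
exists 2%N => // d /= d2; rewrite subr0.
have t4 : 4 <= (2 * d)%:R :> R by rewrite (ler_nat _ 4); lia.
move mE : ((2 * d)%:R - 2 : R) => m.
apply: (@site_pc_ge _ _ _ m) => //; subst m; move: ((2 * d)%:R : R) t4 => t t4.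
- apply/andP; split; first by rewrite addr_gt0 ?divr_gt0 ?invr_gt0 ?exprn_gt0//; lra.
  rewrite (_ : t^-1 + _ = (t + 2) / t ^+ 2); last by field; lra.
  by rewrite ltr_pdivrMr ?exprn_gt0//; nra.
(* With [t = 2d], clearing denominators turns the inequality into [10 < 3 t], which [t >= 4]
   ensures. *)
- rewrite (_ : _ * _ = (t + 2) * ((t - 2) ^+ 2 + 1) / (t ^+ 2 * (t - 2))); last by field; lra.
  rewrite ltr_pdivrMr ?mulr_gt0 ?exprn_gt0//; nra.
Qed.
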